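(* Let $\{\widetilde\mu_n\}_{n\ge 0}$ (real-valued) and $\{\widetilde\sigma_n\}_{n\ge 0}$ (positive) be arbitrary sequences of point estimators adapted to the canonical filtration $\{\mathcal F_n\}_{n\ge 0}$. Then the process $R_0=1$, $$R_n=\left(\frac1n\sum_{i=1}^nX_i^2\right)^{n/2}\mathrm e^{n/2}\prod_{i=1}^n\frac1{\widetilde\sigma_{i-1}}\exp\left\{-\frac12\left(\frac{X_i-\widetilde\mu_{i-1}}{\widetilde\sigma_{i-1}}\right)^2\right\}\qquad(n\ge1)$$ is an e-process for $\mathcal N_{\mu=0}=\{N(0,\sigma^2):\sigma>0\}$ on $\{\mathcal F_n\}$. Consequently, for $\alpha\in(0,1)$ define $$W_n=\frac1{\alpha^{2/n}\mathrm e}\exp\left\{\frac1n\sum_{i=1}^n\left(\log\widetilde\sigma_{i-1}^2+\left(\frac{X_i-\widetilde\mu_{i-1}}{\widetilde\sigma_{i-1}}\right)^2\right)\right\}.$$ Then the intervals $$\mathrm{CI}_n=\left[\widehat\mu_n\pm\sqrt{\widehat\mu_n^2-\overline{X_n^2}+W_n}\right],\qquad n\ge1,$$ form a $(1-\alpha)$-confidence sequence for $\mu$ over $\mathcal N$, i.e. for every $\mu\in\mathbb R$ and $\sigma>0$, if $X_1,X_2,\dots$ are i.i.d. $N(\mu,\sigma^2)$, then $\Pr[\forall n\ge1,\ \mu\in\mathrm{CI}_n]\ge1-\alpha$.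
   Context: $X_1,X_2,\dots$ are real observations; $\mathcal F_n=\sigma(X_1,\dots,X_n)$, with $\mathcal F_0$ trivial. $\widehat\mu_n=\frac1n\sum_{i=1}^nX_i$ and $\overline{X_n^2}=\frac1n\sum_{i=1}^nX_i^2$. $N(\mu,\sigma^2)$ is the normal law with mean $\mu$ and variance $\sigma^2$; $\mathcal N=\{N(\mu,\sigma^2):\mu\in\mathbb R,\sigma>0\}$. ''Adapted'' means $\widetilde\mu_n,\widetilde\sigma_n$ are $\mathcal F_n$-measurable (so $\widetilde\mu_0,\widetilde\sigma_0$ are constants). For a class $\mathcal P$ of distributions on $\mathbb R$, a $[0,\infty]$-valued process $\{M_n\}$ adapted to a filtration $\{\mathcal G_n\}$ is an e-process for $\mathcal P$ on $\{\mathcal G_n\}$ if for every $\{\mathcal G_n\}$-stopping time $\tau$ and every $P\in\mathcal P$, $\mathbb E[M_\tau]\le1$ when $X_1,X_2,\dots$ are i.i.d. from $P$ (with $M_\infty:=\limsup_nM_n$ on $\{\tau=\infty\}$). If the quantity under the square root is negative, $\mathrm{CI}_n$ is the empty set. *)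

(* Defs.v *)
From HB Require Import structures.
From mathcomp Require Export all_boot all_order all_algebra.
From mathcomp Require Export all_classical all_reals all_analysis.
From mathcomp Require Export measurable_realfun.

Set Implicit Arguments.
Unset Strict Implicit.
Unset Printing Implicit Defensive.

Import Order.TTheory GRing.Theory Num.Theory.
Import numFieldNormedType.Exports.

Local Open Scope classical_set_scope.
Local Open Scope ring_scope.

(* Observations are indexed from 0: [X i] stands for the (i+1)-st observation,
   so the first n observations are [X i] for i < n.  Estimators and processes
   keep their indices, so the pair (X_i, estimator of index i-1) of the i-th
   factor becomes the pair ([X i], estimator of index [i]). *)

Section filtrations.
Context {d : measure_display} {T : measurableType d}.

Record filtration := Filtration {
  filtration_sets :> nat -> set_system T ;
  filtration_sigma : forall n, sigma_algebra setT (filtration_sets n) ;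
  filtration_measurable : forall n, filtration_sets n `<=` measurable ;
  filtration_le : forall m n, (m <= n)%N ->
    filtration_sets m `<=` filtration_sets n }.

Definition adapted {d' : measure_display} {U : measurableType d'}
    (G : filtration) (f : nat -> T -> U) : Prop :=
  forall n (B : set U), measurable B -> G n (f n @^-1` B).

(* [None] is the value +oo. *)
Definition stopping_time (G : filtration) (tau : T -> option nat) : Prop :=
  forall n, G n [set w | exists2 k, (k <= n)%N & tau w = Some k].

Context {R : realType}.

Definition stopped (M : nat -> T -> \bar R) (tau : T -> option nat)
    (w : T) : \bar R :=
  if tau w is Some n then M n w else limn_esup (fun n => M n w).

Definition observed (X : nat -> {mfun T >-> R}) (n : nat) : set_system T :=
  <<s \bigcup_(i in `I_n) preimage_set_system setT (X i) measurable >>.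

Lemma observed_sigma X n : sigma_algebra setT (observed X n).
Proof. exact: smallest_sigma_algebra. Qed.

Lemma observed_measurable X n : observed X n `<=` measurable.
Proof.
apply: smallest_sub; first exact: sigma_algebra_measurable.
by move=> _ [i _ [B mB <-]]; exact: measurable_funP.
Qed.

Lemma observed_le X m n : (m <= n)%N -> observed X m `<=` observed X n.
Proof.
move=> mn; apply: smallest_sub; first exact: smallest_sigma_algebra.
move=> A [i /= im XA]; apply: sub_gen_smallest.
by exists i => //=; exact: leq_trans mn.
Qed.

Definition canonical_filtration (X : nat -> {mfun T >-> R}) : filtration :=
  Filtration (observed_sigma X) (@observed_measurable X) (@observed_le X).

End filtrations.
Arguments filtration {d} T.

Section iid.
Context {d : measure_display} {T : measurableType d} {R : realType}.

Definition mutually_independent (P : probability T R)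
    (X : nat -> {mfun T >-> R}) : Prop :=
  forall (s : seq nat) (B : nat -> set R), uniq s ->
    (forall i, measurable (B i)) ->
    P (\bigcap_(i in [set` s]) (X i @^-1` B i)) =
      (\prod_(i <- s) P (X i @^-1` B i))%E.

Definition iid_from (Q : probability (measurableTypeR R) R) (P : probability T R)
    (X : nat -> {mfun T >-> R}) : Prop :=
  mutually_independent P X /\
  (forall i (B : set R), measurable B -> distribution P (X i) B = Q B).

(* The sample space and the observations are fixed; the laws of the class are
   realised by letting the probability measure on the sample space vary. *)
Definition e_process (X : nat -> {mfun T >-> R}) (C : set (probability (measurableTypeR R) R))
    (G : filtration T) (M : nat -> T -> \bar R) : Prop :=
  [/\ adapted G M,
      (forall n w, 0 <= M n w)%E &
      forall tau : T -> option nat, stopping_time G tau ->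
      forall Q : probability (measurableTypeR R) R, C Q ->
      forall P : probability T R, iid_from Q P X ->
        (\int[P]_w stopped M tau w <= 1)%E].

End iid.

(* The second parameter of [normal_prob] is the standard deviation. *)
Definition centered_normals (R : realType) : set (probability (measurableTypeR R) R) :=
  [set (normal_prob 0 s : probability (measurableTypeR R) R) | s in [set s : R | 0 < s]].

Section processes.
Context {d : measure_display} {T : measurableType d} {R : realType}.
Variables (X : nat -> {mfun T >-> R}) (mu sigma : nat -> T -> R).

Definition sample_mean (n : nat) (w : T) : R :=
  n%:R^-1 * \sum_(i < n) X i w.

Definition sample_mean_sq (n : nat) (w : T) : R :=
  n%:R^-1 * \sum_(i < n) X i w ^+ 2.

Definition R_process (n : nat) (w : T) : R :=
  if n == 0%N then 1 else
  sample_mean_sq n w `^ (n%:R / 2) * expR (n%:R / 2) *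
  \prod_(i < n) ((sigma i w)^-1 *
                 expR (- (1 / 2) * ((X i w - mu i w) / sigma i w) ^+ 2)).

Definition W_process (alpha : R) (n : nat) (w : T) : R :=
  (alpha `^ (2 / n%:R) * expR 1)^-1 *
  expR (n%:R^-1 * \sum_(i < n) (ln (sigma i w ^+ 2) +
                                ((X i w - mu i w) / sigma i w) ^+ 2)).

Definition CI (alpha : R) (n : nat) (w : T) : set R :=
  let D := sample_mean n w ^+ 2 - sample_mean_sq n w + W_process alpha n w in
  if 0 <= D then
    [set` `[sample_mean n w - Num.sqrt D, sample_mean n w + Num.sqrt D]]
  else set0.

End processes.

(* Main.v *)
From HB Require Import structures.
From mathcomp Require Import ring lra.
Require Import Defs.

(** Under i.i.d. [N(m, s^2)] observations the likelihood ratio [L_n], the product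
    of the ratios of the [N(mu_i, sigma_i^2)] density to the [N(m, s^2)] density
    at the i-th observation, is a nonnegative martingale: the plugged-in
    parameters are determined by the past, of which the next observation is
    independent.  Since [u <= exp (u - 1)], the smallest value of [L_n] over all
    [s] is [R_n] with [X_i] replaced by [X_i - m] in the second moment, so that
    [L_n] dominates this process.  Optional stopping for [L_n] then bounds the
    stopped process.  On the event that the stopping time is infinite
    the upper limit is needed, so Fatou's lemma has to be combined with the
    almost sure convergence of [L_n], obtained from Doob's upcrossing strategy.
    The confidence sequence is Ville's inequality for the process centered at the
    true mean: [m] lies outside [CI_n] exactly when that process exceeds
    [1 / alpha] at time [n]. *)

Set Implicit Arguments.
Unset Strict Implicit.
Unset Printing Implicit Defensive.

Import Order.TTheory GRing.Theory Num.Theory.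
Import numFieldNormedType.Exports.

Local Open Scope classical_set_scope.
Local Open Scope ring_scope.

(** * Doob's upcrossing strategy along a single path *)

Section upcrossing_strategy.
Context {R : realType}.
Variables (a b : R) (u : nat -> R).

(* Buy when [u <= a], sell when [u >= b], starting from capital [a]. *)
Fixpoint holding (n : nat) : bool :=
  (u n <= a) || (if n is m.+1 then holding m && (u n < b) else false).

Fixpoint capital (n : nat) : R :=
  if n is m.+1 then capital m + (if holding m then u n - u m else 0) else a.

(* The part of the capital not exposed to [u]: it never decreases, and it grows
   by at least [b - a] at each completed upcrossing. *)
Definition banked (n : nat) : R :=
  capital n - (if holding n then u n else a).

Hypothesis ab : a < b.

(** The capital moves together with the exposed amount while a share is held, so only trades change
    [banked]: buying replaces the exposure [a] by a price at most [a], and selling replaces a price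
    at least [b] by [a]. *)
Lemma banked_leS n : banked n <= banked n.+1.
Proof.
rewrite /banked /=; case: (holding n) => /=.
  by case: (leP (u n.+1) a); case: (ltP (u n.+1) b) => /=; lra.
by rewrite orbF; have [|] := leP (u n.+1) a; lra.
Qed.

Lemma banked_sell n : holding n -> ~~ holding n.+1 ->
  banked n + (b - a) <= banked n.+1.
Proof.
move=> hn hn1; rewrite /banked hn (negbTE hn1) /= hn.
move: hn1; rewrite /= hn /=.
by case: (leP (u n.+1) a); case: (ltP (u n.+1) b) => /=; lra.
Qed.

Lemma banked_ge0 n : 0 <= banked n.
Proof.
elim: n => [|n IH]; last exact: le_trans IH (banked_leS n).
by rewrite /banked /= orbF; case: ifP => //; lra.
Qed.

Lemma banked_le m n : (m <= n)%N -> banked m <= banked n.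
Proof.
move=> /subnK <-; elim: (n - m)%N => // k IH.
by rewrite addSn; exact: le_trans IH (banked_leS _).
Qed.

Lemma banked_le_capital n : 0 <= a -> 0 <= u n -> banked n <= capital n.
Proof. by move=> a0 u0; rewrite /banked; case: ifP => _; lra. Qed.

Lemma banked_upcrossing m n : (m <= n)%N -> holding m -> ~~ holding n ->
  banked m + (b - a) <= banked n.
Proof.
elim: n => [|n IH]; first by rewrite leqn0 => /eqP -> ->.
rewrite leq_eqVlt => /predU1P[->|]; first by move=> ->.
rewrite ltnS => mn hm hn1.
(* The sale takes place either in the last step or earlier, where induction applies. *)
have [hn|hn] := boolP (holding n).
  by apply: le_trans (banked_sell hn hn1); rewrite lerD2r banked_le.
exact: le_trans (IH mn hm hn) (banked_leS n).
Qed.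

(** Whatever the past, a value at most [a] forces holding and a value at least [b] forces not
    holding. A low time followed by a high time therefore completes one more upcrossing. *)
Lemma banked_unbounded :
  (forall N, exists2 n, (N <= n)%N & u n <= a) ->
  (forall N, exists2 n, (N <= n)%N & b <= u n) ->
  forall k : nat, exists N, k%:R * (b - a) <= banked N.
Proof.
move=> low high; elim=> [|k [N IH]].
  by exists 0%N; rewrite mul0r banked_ge0.
have [i Ni ui] := low N; have [j ij uj] := high i; exists j.
have hi : holding i by case: i ui {Ni ij} => [|i] /= ->.
have hj : ~~ holding j.
  have : ~~ (u j <= a) && ~~ (u j < b) by rewrite -ltNge -leNgt uj (lt_le_trans ab).
  by case: j uj {ij} => [|j] /= _ /andP[/negbTE-> /negbTE ujb] //; rewrite ujb andbF.
have := banked_upcrossing ij hi hj; have := banked_le Ni.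
by rewrite -natr1; lra.
Qed.

End upcrossing_strategy.

(** * Lower and upper limits of extended real sequences *)

Section limn_e_extra.
Context {R : realType}.
Implicit Types u v : nat -> \bar R.

Lemma limn_esupE u : limn_esup u = ereal_inf (range (esups u)).
Proof. by rewrite limn_esup_lim; apply/cvg_lim => //; exact: cvg_esups_inf. Qed.

Lemma limn_einfE u : limn_einf u = ereal_sup (range (einfs u)).
Proof. by rewrite limn_einf_lim; apply/cvg_lim => //; exact: cvg_einfs_sup. Qed.

Lemma le_limn_esup u v : (forall n, (u n <= v n)%E) ->
  (limn_esup u <= limn_esup v)%E.
Proof.
move=> uv; rewrite !limn_esup_lim; apply: lee_lim;
  [exact: is_cvg_esups|exact: is_cvg_esups|].
apply: nearW => n; apply: ge_ereal_sup => _ [k /= nk <-].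
by apply: le_trans (uv k) _; apply: ereal_sup_ubound; exists k.
Qed.

Lemma limn_einf_ge0 u : (forall n, (0 <= u n)%E) -> (0 <= limn_einf u)%E.
Proof.
move=> u0; rewrite limn_einfE; apply: le_trans (ereal_sup_ubound _); last by exists 0%N.
by apply: le_ereal_inf_tmp => _ [k _ <-].
Qed.

Lemma limn_einf_le u l : (forall n, (u n <= l)%E) -> (limn_einf u <= l)%E.
Proof.
move=> ul; rewrite limn_einfE; apply: ge_ereal_sup => _ [n _ <-].
by apply: le_trans (ul n); apply: ereal_inf_lbound; exists n => /=.
Qed.

Lemma limn_einf_lt_io u (l : \bar R) : (limn_einf u < l)%E ->
  forall N, exists2 n, (N <= n)%N & (u n < l)%E.
Proof.
rewrite limn_einfE => ul N.
have /ereal_inf_lt[_ [n /= Nn <-] unl] : (einfs u N < l)%E.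
  by apply: le_lt_trans ul; apply: ereal_sup_ubound; exists N.
by exists n.
Qed.

Lemma limn_esup_gt_io u (l : \bar R) : (l < limn_esup u)%E ->
  forall N, exists2 n, (N <= n)%N & (l < u n)%E.
Proof.
rewrite limn_esupE => ul N.
have /ereal_sup_gt[_ [n /= Nn <-] unl] : (l < esups u N)%E.
  by apply: lt_le_trans ul _; apply: ereal_inf_lbound; exists N.
by exists n.
Qed.

(** Rational levels make the oscillation events a countable family, so that their null sets can be
    united. Nonnegativity supplies [0 <= ratr p], the initial capital of the upcrossing strategy. *)
Lemma limn_einf_esup_rat_gap (u : nat -> R) : (forall n, 0 <= u n) ->
  (limn_einf (EFin \o u) < limn_esup (EFin \o u))%E ->
  exists p q : rat, [/\ 0 <= ratr p :> R, ratr p < ratr q :> R,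
    forall N, exists2 n, (N <= n)%N & u n <= ratr p &
    forall N, exists2 n, (N <= n)%N & ratr q <= u n].
Proof.
move=> u0 gap.
have l0 : (0 <= limn_einf (EFin \o u))%E by apply: limn_einf_ge0 => n; rewrite lee_fin.
have [x lx] : exists x, limn_einf (EFin \o u) = x%:E.
  exists (fine (limn_einf (EFin \o u))); rewrite fineK// ge0_fin_numE//.
  exact: lt_le_trans gap (leey _).
(* The upper limit may be infinite, so a real level is placed below it first. *)
have [y xy yl] : exists2 y : R, x < y & (y%:E <= limn_esup (EFin \o u))%E.
  move: gap; rewrite lx; case: (limn_esup _) => [r| |//]; last first.
    by exists (x + 1); rewrite ?ltrDl ?leey.
  by rewrite lte_fin => xr; exists r.
rewrite lx lee_fin in l0.
have [p] := rat_in_itvoo xy; rewrite in_itv/= => /andP[xp py].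
have [q] := rat_in_itvoo py; rewrite in_itv/= => /andP[pq qy].
exists p, q; split => //; first exact: le_trans l0 (ltW xp).
  move=> N; have [|n Nn] := @limn_einf_lt_io (EFin \o u) (ratr p)%:E _ N.
    by rewrite lx lte_fin.
  by rewrite lte_fin => /ltW unp; exists n.
move=> N; have [|n Nn] := @limn_esup_gt_io (EFin \o u) (ratr q)%:E _ N.
  by apply: lt_le_trans yl; rewrite lte_fin.
by rewrite lte_fin => /ltW unp; exists n.
Qed.

End limn_e_extra.

Lemma measurable_fun_limn_einf {d} {T : measurableType d} {R : realType}
    (f : nat -> T -> \bar R) :
  (forall n, measurable_fun setT (f n)) ->
  measurable_fun setT (fun w => limn_einf (f ^~ w)).
Proof.
move=> mf.
rewrite (_ : (fun w => _) = fun w => (- limn_esup (fun n => - f n w))%E)//.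
apply: measurableT_comp => //.
apply: (@measurable_fun_limn_esup _ _ _ _ (fun n w => (- f n w)%E)) => n.
exact: measurableT_comp.
Qed.

Lemma measurable_funV_gt0 {d} {T : measurableType d} {R : realType}
    (f : T -> R) :
  (forall w, 0 < f w) -> measurable_fun setT f ->
  measurable_fun setT (fun w => (f w)^-1).
Proof.
move=> f0 mf; rewrite (_ : (fun w => _) = fun w => expR (- ln (f w))).
  apply: measurableT_comp => //; apply: measurable_funN.
  by apply: measurableT_comp => //; exact: measurable_ln.
by apply/funext => w; rewrite expRN lnK// posrE.
Qed.

(** * Filtrations and stopped processes *)

Section filtration_theory.
Context {d : measure_display} {T : measurableType d}.
Variable G : filtration T.

(** A sigma-algebra generates itself; closure properties of measurable sets thus transfer to
    [G n]. *)
Lemma filtration_measurableE n :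
  (G n).-sigma.-measurable = G n :> set (set T).
Proof. exact/measurable_g_measurableTypeE/filtration_sigma. Qed.

Lemma filtrationT n : G n setT.
Proof. by rewrite -filtration_measurableE; exact: measurableT. Qed.

Lemma filtrationC n A : G n A -> G n (~` A).
Proof. by rewrite -filtration_measurableE; exact: measurableC. Qed.

Lemma filtrationU n A B : G n A -> G n B -> G n (A `|` B).
Proof. by rewrite -filtration_measurableE; exact: measurableU. Qed.

Lemma filtrationI n A B : G n A -> G n B -> G n (A `&` B).
Proof. by rewrite -filtration_measurableE; exact: measurableI. Qed.

Lemma adapted_measurable {d'} {U : measurableType d'} (f : nat -> T -> U) n :
  adapted G f -> measurable_fun setT (f n).
Proof.
by move=> Gf _ B mB; rewrite setTI; apply: (filtration_measurable (n := n)); exact: Gf.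
Qed.

Context {R : realType}.
Implicit Types (M : nat -> T -> R) (tau : T -> option nat).

Definition stop (M : nat -> T -> R) (tau : T -> option nat) (n : nat) (w : T) : R :=
  M (if tau w is Some k then minn k n else n) w.

Lemma stopped_limn_esup M tau w :
  stopped (fun n w => (M n w)%:E) tau w =
  limn_esup (fun n => (stop M tau n w)%:E).
Proof.
rewrite /stopped /stop; case: (tau w) => [k|//].
have /cvg_limn_einf_sup[_ ->//] : (M (minn k n) w)%:E @[n --> \oo] --> (M k w)%:E.
apply: cvg_near_cst; by exists k => //= n kn; rewrite (minn_idPl kn).
Qed.

Definition stopped_by (tau : T -> option nat) n : set T :=
  [set w | exists2 k, (k <= n)%N & tau w = Some k].

Lemma stopS_stopped M tau n w : stopped_by tau n w ->
  stop M tau n.+1 w = stop M tau n w.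
Proof.
by move=> [k kn tk]; rewrite /stop tk (minn_idPl kn) (minn_idPl (leqW kn)).
Qed.

Lemma stop_running M tau n w : ~ stopped_by tau n w ->
  stop M tau n w = M n w /\ stop M tau n.+1 w = M n.+1 w.
Proof.
move=> ns; rewrite /stop; case tk : (tau w) => [k|//].
have nk : (n < k)%N by rewrite ltnNge; apply/negP => kn; apply: ns; exists k.
by rewrite (minn_idPr nk) (minn_idPr (ltnW nk)).
Qed.

Lemma adapted_stop M tau : adapted G M -> stopping_time G tau ->
  adapted G (stop M tau).
Proof.
move=> GM Gtau; elim=> [|n IH] B mB.
  have -> : stop M tau 0 = M 0%N.
    by apply/funext => w; rewrite /stop; case: (tau w) => [k|//]; rewrite minn0.
  exact: GM.
(* Whether [tau] has occurred by time [n] is known at time [n]; on either side of this alternative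
   the stopped value is known by time [n.+1]. *)
have -> : stop M tau n.+1 @^-1` B =
    (stopped_by tau n `&` stop M tau n @^-1` B) `|`
    (~` stopped_by tau n `&` M n.+1 @^-1` B).
  apply/seteqP; split=> w /=.
    have [sw|sw] := pselect (stopped_by tau n w).
      by rewrite stopS_stopped//; left.
    by rewrite (stop_running M sw).2; right.
  by move=> [[sw]|[sw]]; [rewrite stopS_stopped|rewrite (stop_running M sw).2].
apply: filtrationU; apply: filtrationI.
- by apply: (filtration_le (leqnSn n)); exact: Gtau.
- by apply: (filtration_le (leqnSn n)); exact: IH.
- by apply/filtrationC/(filtration_le (leqnSn n)); exact: Gtau.
- exact: GM.
Qed.

Lemma measurable_stopped M tau : adapted G M -> stopping_time G tau ->
  measurable_fun setT (stopped (fun n w => (M n w)%:E) tau).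
Proof.
move=> GM Gtau.
rewrite (_ : stopped _ _ = fun w => limn_esup (fun n => (stop M tau n w)%:E)).
  apply: (@measurable_fun_limn_esup _ _ _ _ (fun n w => (stop M tau n w)%:E)) => n.
  by apply/measurable_EFinP/adapted_measurable/adapted_stop.
by apply/funext => w; exact: stopped_limn_esup.
Qed.

End filtration_theory.

(** * Convergence and optional stopping of nonnegative supermartingales *)

Section nonnegative_supermartingales.
Context {d : measure_display} {T : measurableType d} {R : realType}.
Variables (P : probability T R) (G : filtration T).
Implicit Types M : nat -> T -> R.

(** The conditional expectation inequality is tested on the events of [G n]; for nonnegative
    processes these integrals always make sense. *)
Definition ge0_supermartingale M : Prop :=
  [/\ adapted G M, (forall n w, 0 <= M n w) &
      forall n A, G n A ->
        (\int[P]_(w in A) (M n.+1 w)%:E <= \int[P]_(w in A) (M n w)%:E)%E].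

(** An event of [G n] is cut by [stopped_by tau n], itself in [G n]: on one piece the stopped
    process no longer moves, on the other it makes the same step as [M]. *)
Lemma stop_supermartingale M tau : ge0_supermartingale M -> stopping_time G tau ->
  ge0_supermartingale (stop M tau).
Proof.
move=> [GM M0 dM] Gtau; have GS := adapted_stop GM Gtau.
split=> // [n w|n A GA]; first exact: M0.
have mGA B : G n B -> measurable B by exact: filtration_measurable.
have GB1 : G n (A `&` stopped_by tau n) by apply: filtrationI => //; exact: Gtau.
have GB2 : G n (A `&` ~` stopped_by tau n).
  by apply: filtrationI => //; apply: filtrationC; exact: Gtau.
have AE : A = (A `&` stopped_by tau n) `|` (A `&` ~` stopped_by tau n).
  by rewrite -setIUr setUv setIT.
have mS k D : measurable_fun D (EFin \o stop M tau k).
  by apply/measurable_funTS/measurable_EFinP/(adapted_measurable k GS).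
have disj : [disjoint A `&` stopped_by tau n & A `&` ~` stopped_by tau n].
  by apply/disj_setPS => w [[_ ?] [_ ?]].
rewrite AE !ge0_integral_setU//; try exact: mGA; try exact: mS.
- apply: leeD.
    by rewrite le_eqVlt; apply/orP; left; apply/eqP/eq_integral => w /set_mem[_ sw];
      rewrite stopS_stopped.
  rewrite (eq_integral (fun w => (M n.+1 w)%:E)); last first.
    by move=> w /set_mem[_ /(stop_running M)[_ ->]].
  rewrite [leRHS](eq_integral (fun w => (M n w)%:E)); last first.
    by move=> w /set_mem[_ /(stop_running M)[-> _]].
  exact: dM.
- by move=> w _; rewrite lee_fin; exact: M0.
- by move=> w _; rewrite lee_fin; exact: M0.
Qed.

Section supermartingale_limit.
Variables (M : nat -> T -> R) (superM : ge0_supermartingale M).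
Hypothesis intM0 : (\int[P]_w (M 0 w)%:E < +oo)%E.

Let GM : adapted G M. Proof. by case: superM. Qed.
Let M_ge0 n w : 0 <= M n w. Proof. by case: superM. Qed.
Let dM n A : G n A ->
  (\int[P]_(w in A) (M n.+1 w)%:E <= \int[P]_(w in A) (M n w)%:E)%E.
Proof. by case: superM => _ _; exact. Qed.
Let mM n : measurable_fun setT (M n). Proof. exact: adapted_measurable GM. Qed.

Lemma supermartingale_integral_le n :
  (\int[P]_w (M n w)%:E <= \int[P]_w (M 0 w)%:E)%E.
Proof. by elim: n => // n; apply: le_trans; apply: dM; exact: filtrationT. Qed.

Section upcrossings.
Variables (a b : R) (a0 : 0 <= a) (ab : a < b).

(** The strategy is run along the paths of [M]. As [H n] lies in [G n], the position over the next
    step is chosen without seeing that step. *)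
Let H n : set T := [set w | holding a b (M ^~ w) n].
Let K n (w : T) : R := capital a b (M ^~ w) n.

Let GH n : G n (H n).
Proof.
elim: n => [|n IH].
  rewrite /H /= (_ : [set w | _] = M 0%N @^-1` `]-oo, a]).
    by apply: GM; exact: measurable_itv.
  by apply/seteqP; split => w /=; rewrite in_itv/= orbF.
rewrite /H /= (_ : [set w | _] = (M n.+1 @^-1` `]-oo, a]) `|`
    (H n `&` M n.+1 @^-1` `]-oo, b[)).
  apply: filtrationU; first by apply: GM; exact: measurable_itv.
  apply: filtrationI; first exact: (filtration_le (leqnSn n)).
  by apply: GM; exact: measurable_itv.
apply/seteqP; split => w /=; rewrite !in_itv/=.
  by move=> /orP[Ma|/andP[hn Mb]]; [left|right].
by move=> [Ma|[hn Mb]]; apply/orP; [left|right; apply/andP].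
Qed.

Let K_ge0 n w : 0 <= K n w.
Proof.
by apply: le_trans (banked_ge0 a b (M ^~ w) n) _; exact: banked_le_capital.
Qed.

Let KS n w : K n.+1 w = K n w + (if w \in H n then M n.+1 w - M n w else 0).
Proof.
have -> // : (w \in H n) = holding a b (M ^~ w) n.
by apply/idP/idP => [/set_mem|h]; last exact/mem_set.
Qed.

Let mK n : measurable_fun setT (K n).
Proof.
elim: n => [|n IH]; first exact: measurable_cst.
rewrite (_ : K n.+1 = fun w => K n w + \1_(H n) w * (M n.+1 w - M n w)).
  apply: measurable_funD => //; apply: measurable_funM; last exact: measurable_funB.
  by apply: measurable_indic; exact: (filtration_measurable (GH n)).
by apply/funext => w; rewrite KS indicE; case: (w \in H n); rewrite ?mul1r ?mul0r.
Qed.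

Let integral_K n : (\int[P]_w (K n w)%:E <= a%:E)%E.
Proof.
elim: n => [|n].
  by rewrite (integral_cst P measurableT a%:E)/= probability_setT mule1.
apply: le_trans.
have mH : measurable (H n) := filtration_measurable (GH n).
have finM k : (\int[P]_(w in H n) (M k w)%:E \is a fin_num)%E.
  rewrite ge0_fin_numE; last by apply: integral_ge0 => w _; rewrite lee_fin.
  apply: le_lt_trans intM0; apply: le_trans (supermartingale_integral_le k).
  apply: ge0_subset_integral => //; first exact/measurable_EFinP.
  by move=> w _; rewrite lee_fin.
have mMH k : measurable_fun setT (fun w => ((\1_(H n) w * M k w)%R)%:E).
  by apply/measurable_EFinP/measurable_funM => //; exact: measurable_indic.
have MHE k : (\int[P]_w (\1_(H n) w * M k w)%:E)%E = (\int[P]_(w in H n) (M k w)%:E)%E.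
  rewrite [RHS]integral_mkcond; apply: eq_integral => w _.
  by rewrite patchE indicE; case: (w \in H n); rewrite ?mul1r ?mul0r.
(* Adding the finite integral of [M n] over [H n] to both sides keeps every integrand nonnegative,
   although the gain [M n.+1 - M n] is signed. *)
rewrite -(leeD2rE _ _ (finM n)) -{1}MHE.
rewrite -ge0_integralD//; first last.
- by move=> w _; rewrite lee_fin mulr_ge0.
- exact/measurable_EFinP.
- by move=> w _; rewrite lee_fin.
apply: le_trans (leeD2l _ (dM (GH n))).
rewrite -MHE -ge0_integralD//; first last.
- by move=> w _; rewrite lee_fin mulr_ge0.
- exact/measurable_EFinP.
- by move=> w _; rewrite lee_fin.
rewrite le_eqVlt; apply/orP; left; apply/eqP/eq_integral => w _.
by rewrite -!EFinD KS indicE; case: (w \in H n) => /=; congr EFin; ring.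
Qed.

(** The expected capital stays at most [a], so by Fatou its lower limit is integrable, hence almost
    surely finite. Infinitely many upcrossings would make it infinite, because [banked] is
    nondecreasing, unbounded and below the capital. *)
Lemma ae_finite_upcrossings : {ae P, forall w,
  ~ ((forall N, exists2 n, (N <= n)%N & M n w <= a) /\
     (forall N, exists2 n, (N <= n)%N & b <= M n w))}.
Proof.
have iK : P.-integrable setT (fun w => limn_einf (fun n => (K n w)%:E)).
  apply/integrableP; split.
    apply: (measurable_fun_limn_einf (f := fun n w => (K n w)%:E)) => n.
    exact/measurable_EFinP.
  under eq_integral => w _.
    rewrite gee0_abs; last by apply: limn_einf_ge0 => n; rewrite lee_fin.
    over.
  apply: (@le_lt_trans _ _ a%:E); last exact: ltry.
  apply: le_trans (fatou _ _ _ _) _ => //.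
  - by move=> n; exact/measurable_EFinP.
  - by move=> n w _; rewrite lee_fin.
  - by apply: limn_einf_le => n; exact: integral_K.
apply: filterS (integrable_ae measurableT iK) => w /(_ I) finK [low high].
move: finK; rewrite fin_numE => /andP[_ /eqP]; apply.
apply: eq_infty => r.
have [k kr] : exists k : nat, r <= k%:R * (b - a).
  exists (Num.truncn (r / (b - a))).+1; rewrite -ler_pdivrMr ?subr_gt0//.
  exact/ltW/truncnS_gt.
have [N kN] := banked_unbounded ab low high k.
rewrite limn_einfE; apply: le_trans (ereal_sup_ubound _); last by exists N.
apply: le_ereal_inf_tmp => _ [n /= Nn <-]; rewrite lee_fin.
apply: (le_trans kr); apply: (le_trans kN).
by apply: le_trans (banked_le a b _ Nn) _; exact: banked_le_capital.
Qed.

End upcrossings.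

Lemma ae_limn_esup_le_einf : {ae P, forall w,
  (limn_esup (fun n => (M n w)%:E) <= limn_einf (fun n => (M n w)%:E))%E}.
Proof.
pose bad (pq : rat * rat) w := [/\ 0 <= ratr pq.1 :> R, ratr pq.1 < ratr pq.2 :> R,
    forall N, exists2 n, (N <= n)%N & M n w <= ratr pq.1 &
    forall N, exists2 n, (N <= n)%N & ratr pq.2 <= M n w].
(* Enumerating the rational pairs by [unpickle] merges the null sets of all pairs into one. *)
have : {ae P, forall w, forall n, forall pq, unpickle n = Some pq -> ~ bad pq w}.
  apply: ae_foralln => n; case: (unpickle n) => [[p q]|]; last exact: aeW.
  have [/andP[p0 pq]|npq] := boolP ((0 <= ratr p :> R) && (ratr p < ratr q :> R)).
    apply: filterS (ae_finite_upcrossings p0 pq) => w h _ [<-] [_ _ lo hi].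
    exact: h.
  by apply: aeW => w _ [<-] [p0 pq _ _]; rewrite p0 pq in npq.
apply: filterS => w h; rewrite leNgt; apply/negP.
move=> /limn_einf_esup_rat_gap[//|p [q [p0 pq lo hi]]].
exact: (h (pickle (p, q)) (p, q) (pickleK _)).
Qed.

(** Fatou's lemma controls only the lower limit; almost sure convergence transfers the bound to the
    upper limit. *)
Lemma integral_limn_esup_le :
  (\int[P]_w limn_esup (fun n => (M n w)%:E) <= \int[P]_w (M 0 w)%:E)%E.
Proof.
have mEM n : measurable_fun setT (fun w => (M n w)%:E) by exact/measurable_EFinP.
apply: (@le_trans _ _ (\int[P]_w limn_einf (fun n => (M n w)%:E)))%E.
  apply: ae_ge0_le_integral => //.
  - move=> w _; apply: le_trans (limn_einf_sup _).
    by apply: limn_einf_ge0 => n; rewrite lee_fin.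
  - exact: (@measurable_fun_limn_esup _ _ _ _ (fun n w => (M n w)%:E)).
  - by move=> w _; apply: limn_einf_ge0 => n; rewrite lee_fin.
  - exact: (measurable_fun_limn_einf (f := fun n w => (M n w)%:E)).
  - by apply: filterS ae_limn_esup_le_einf.
apply: le_trans (fatou _ _ _ _) _ => //.
- by move=> n w _; rewrite lee_fin.
- by apply: limn_einf_le => n; exact: supermartingale_integral_le.
Qed.

End supermartingale_limit.

Lemma stopped_supermartingale_le M tau :
  ge0_supermartingale M -> (\int[P]_w (M 0 w)%:E < +oo)%E ->
  stopping_time G tau ->
  (\int[P]_w stopped (fun n w => (M n w)%:E) tau w <= \int[P]_w (M 0 w)%:E)%E.
Proof.
move=> superM intM0 Gtau.
have stop0 w : stop M tau 0 w = M 0%N w.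
  by rewrite /stop; case: (tau w) => [k|//]; rewrite minn0.
under eq_integral do rewrite stopped_limn_esup.
rewrite -(eq_integral (fun w => (M 0%N w)%:E)
  (fun w => (stop M tau 0 w)%:E)); last first.
  by move=> w _; rewrite stop0.
apply: integral_limn_esup_le; first exact: stop_supermartingale.
by under eq_integral do rewrite stop0.
Qed.

End nonnegative_supermartingales.

(** * Integration against an independent variable *)

Section independence.
Context {d d' : measure_display} {T : measurableType d} {U : measurableType d'}.
Context {R : realType}.
Variables (P : probability T R) (F : set_system T).
Hypotheses (sF : sigma_algebra setT F) (mF : F `<=` measurable).
Variables (Y : {mfun T >-> U}) (Q : probability U R).
Hypothesis indep : forall A B, F A -> measurable B ->
  P (A `&` Y @^-1` B) = (P A * Q B)%E.

Local Notation TF := (g_sigma_algebraType F).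

Let measurable_idF : measurable_fun setT (id : T -> TF).
Proof.
move=> _ A; rewrite measurable_g_measurableTypeE// setTI preimage_id.
exact: mF.
Qed.

Let idF : {mfun T >-> TF} :=
  HB.pack (id : T -> TF) (isMeasurableFun.Build _ _ _ _ _ measurable_idF).

Let measurable_joint : measurable_fun setT (fun w : T => (w : TF, Y w)).
Proof. exact: measurable_fun_pair. Qed.

Let joint : {mfun T >-> (TF * U)%type} :=
  HB.pack (fun w : T => (w : TF, Y w))
    (isMeasurableFun.Build _ _ _ _ _ measurable_joint).

(** The space is paired with [Y] after keeping only [F] as its measurable sets. The joint law agrees
    with the product on rectangles, hence everywhere, and Tonelli integrates [Y] out with the past
    frozen. *)
Lemma ge0_integral_independent (f : TF * U -> \bar R) :
  measurable_fun setT f -> (forall z, (0 <= f z)%E) ->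
  (\int[P]_w f (w, Y w) = \int[P]_w \int[Q]_y f (w, y))%E.
Proof.
move=> mf f0.
transitivity (\int[distribution P joint]_z f z)%E.
  by rewrite ge0_integral_distribution.
transitivity (\int[(distribution P idF \x Q)%E]_z f z)%E.
  apply: eq_measure_integral => A mA _; apply/esym.
  apply: product_measure_unique => // B C mB mC.
  by rewrite -[RHS](@indep B C)// -(measurable_g_measurableTypeE sF).
rewrite fubini_tonelli1// ge0_integral_distribution//.
- exact: measurable_fun_fubini_tonelli_F.
- by move=> w; apply: integral_ge0.
Qed.

End independence.

(** * Measurability with respect to the observed past *)

Section canonical_filtration_theory.
Context {d : measure_display} {T : measurableType d} {R : realType}.
Variable X : nat -> {mfun T >-> R}.

Local Notation TX n := (g_sigma_algebraType (observed X n)).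

Lemma measurable_observedE n :
  (observed X n).-sigma.-measurable = observed X n :> set (set T).
Proof. exact: (filtration_measurableE (canonical_filtration X)). Qed.

Lemma adapted_canonicalP {d'} {U : measurableType d'} (f : nat -> T -> U) :
  adapted (canonical_filtration X) f <->
  forall n, measurable_fun setT (f n : TX n -> U).
Proof.
split=> [h n _ B mB|h n B mB].
  by rewrite setTI measurable_observedE; exact: h.
by have := h n measurableT B mB; rewrite setTI measurable_observedE.
Qed.

Lemma measurable_observed_le m n {d'} {U : measurableType d'} (f : T -> U) :
  (m <= n)%N ->
  measurable_fun setT (f : TX m -> U) -> measurable_fun setT (f : TX n -> U).
Proof.
move=> mn mf _ B mB; have := mf measurableT B mB.
by rewrite !setTI !measurable_observedE; exact: observed_le.
Qed.

Lemma measurable_observation i n : (i < n)%N ->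
  measurable_fun setT (X i : TX n -> R).
Proof.
move=> ltin _ B mB; rewrite setTI measurable_observedE.
by apply: sub_sigma_algebra; exists i => //; exists B => //; rewrite setTI.
Qed.

End canonical_filtration_theory.

(** * Likelihood ratio products of i.i.d. observations *)

Section iid_observations.
Context {d : measure_display} {T : measurableType d} {R : realType}.
Variables (P : probability T R) (X : nat -> {mfun T >-> R}).
Variable Q : probability (measurableTypeR R) R.
Local Notation mR := (measurableTypeR R).
Hypothesis iidX : iid_from Q P X.

(* The preimages under single observations are not closed under intersection;
   the cylinders are, and they also generate [observed X n]. *)
Let cylinder (n : nat) (B : nat -> set R) : set T :=
  \bigcap_(i in [set` iota 0 n]) (X i @^-1` B i).

Let cylinders n : set_system T :=
  [set cylinder n B | B in [set B | forall i, measurable (B i)]].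

Let measurable_cylinder n B : (forall i, measurable (B i)) -> measurable (cylinder n B).
Proof.
move=> mB; apply: fin_bigcap_measurable => // i _.
by rewrite -[_ @^-1` _]setTI; exact: measurable_funP.
Qed.

Let observed_sub_cylinders n : observed X n `<=` <<s cylinders n >>.
Proof.
apply: smallest_sub; first exact: smallest_sigma_algebra.
move=> _ [i /= ltin [B mB <-]]; apply: sub_sigma_algebra.
exists (fun j => if j == i then B else setT).
  by move=> j; case: eqP.
rewrite setTI; apply/seteqP; split => w /=.
  by move=> /(_ i) /=; rewrite mem_iota eqxx; exact.
by move=> XB j /= _; case: eqP => [->|].
Qed.

(** For fixed [B] both sides are finite measures in [A] that agree on the cylinders, so uniqueness
    of measures on a generating family closed under intersection applies. *)
Lemma observed_independent n A B : observed X n A -> measurable B ->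
  P (A `&` X n @^-1` B) = (P A * Q B)%E.
Proof.
move=> nA mB; have [indX lawX] := iidX.
have mXB : measurable (X n @^-1` B).
  by rewrite -[_ @^-1` _]setTI; exact: measurable_funP.
have QB : Q B = P (X n @^-1` B) by rewrite -(lawX n B).
pose c := NngNum (fine_ge0 (measure_ge0 P (X n @^-1` B))).
have cE C : mscale c P C = (P C * Q B)%E.
  by rewrite /mscale /= fineK ?fin_num_measure// QB muleC.
rewrite -cE -[LHS]/(mrestr P mXB A).
apply: (@g_sigma_algebra_measure_unique _ _ _ (cylinders n) _ (fun=> setT)).
- by move=> _ [C mC <-]; exact: measurable_cylinder.
- by move=> _; exists (fun=> setT) => //; apply/seteqP; split.
- by rewrite bigcup_const//; exists 0%N.
- move=> _ _ [C mC <-] [D mD <-]; exists (fun i => C i `&` D i).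
    by move=> i; exact: measurableI.
  by rewrite /cylinder; under eq_bigcapr do rewrite preimage_setI; rewrite bigcapI.
- move=> _ [C mC <-]; rewrite [RHS]cE QB muleC /= /mrestr.
  pose D i := if i == n then B else C i.
  have notn i : i \in iota 0 n -> (i == n) = false.
    by rewrite mem_iota add0n => /= /ltn_eqF.
  (* Mutual independence is used twice: for the indices up to [n], and for those below [n] alone. *)
  have := indX (n :: iota 0 n) D.
  have Dn : D n = B by rewrite /D eqxx.
  rewrite big_cons Dn.
  have -> : (\prod_(i <- iota 0 n) P (X i @^-1` D i) =
             \prod_(i <- iota 0 n) P (X i @^-1` C i))%E.
    by apply: eq_big_seq => i /notn; rewrite /D => ->.
  rewrite -indX ?iota_uniq// => <-.
  + congr (P _); apply/seteqP; split => w.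
      move=> [cw Bw] i /=; rewrite inE => /orP[/eqP->|iin]; first by rewrite /D eqxx.
      by rewrite /D (notn _ iin); exact: cw.
    move=> Dw; split.
      by move=> i iin; have := Dw i; rewrite /= inE iin orbT /D notn//; exact.
    by have := Dw n; rewrite /= inE eqxx /D eqxx; exact.
  + by rewrite /= mem_iota add0n ltnn iota_uniq.
  + by move=> i; rewrite /D; case: eqP.
- move=> _; rewrite /mrestr/=.
  by apply: le_lt_trans (probability_le1 _ _) (ltry _); exact: measurableI.
- exact: observed_sub_cylinders.
Qed.

Section likelihood_ratio.
Variable g : nat -> T -> R -> R.
(** Joint measurability over the observed past and the line says that the [n]-th factor is chosen
    before the next observation is seen. *)
Hypothesis mg : forall n,
  measurable_fun setT (fun z : g_sigma_algebraType (observed X n) * mR => g n z.1 z.2).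
Hypothesis g_ge0 : forall n w y, 0 <= g n w y.
Hypothesis int_g : forall n w, (\int[Q]_y (g n w y)%:E <= 1)%E.

Definition factor_product n w := \prod_(i < n) g i w (X i w).

Local Notation TX n := (g_sigma_algebraType (observed X n)).

Lemma measurable_factor_product n : measurable_fun setT (factor_product n : TX n -> R).
Proof.
elim: n => [|n IH].
  rewrite (_ : factor_product 0 = cst 1); first exact: measurable_cst.
  by apply/funext => w; rewrite /factor_product big_ord0.
rewrite (_ : factor_product n.+1 = fun w => factor_product n w * g n w (X n w)).
  apply: measurable_funM; first exact: measurable_observed_le IH.
  apply: (@measurableT_comp _ _ _ _ _ _ (fun z : TX n * mR => g n z.1 z.2) _
    (fun w : TX n.+1 => (w : TX n, X n w))) => //.
  apply: measurable_fun_pair; last exact: measurable_observation.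
  by apply: (@measurable_observed_le _ _ _ X n n.+1 _ (TX n) id) => //; exact: measurable_id.
by apply/funext => w; rewrite /factor_product big_ord_recr.
Qed.

Lemma factor_product_ge0 n w : 0 <= factor_product n w.
Proof. by apply: prodr_ge0 => i _. Qed.

(** On an event of the past, the next observation is integrated out first; its factor has integral
    at most 1, and what remains is the previous product. *)
Lemma factor_product_supermartingale :
  ge0_supermartingale P (canonical_filtration X) factor_product.
Proof.
split.
- by apply/adapted_canonicalP => n; exact: measurable_factor_product.
- exact: factor_product_ge0.
- move=> n A /= nA.
  pose f (z : TX n * mR) : \bar R :=
    ((\1_A z.1 * factor_product n z.1) * g n z.1 z.2)%:E.
  have mA : measurable_fun setT (\1_A : TX n -> R).
    by apply: measurable_indic; rewrite measurable_observedE.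
  have mLA : measurable_fun setT ((fun w => \1_A w * factor_product n w) : TX n -> R).
    by apply: measurable_funM => //; exact: measurable_factor_product.
  have mf : measurable_fun setT f.
    apply/measurable_EFinP/measurable_funM => //.
    exact: (measurableT_comp mLA (@measurable_fst _ _ (TX n) mR)).
  have LA0 w : 0 <= \1_A w * factor_product n w.
    by rewrite mulr_ge0// factor_product_ge0.
  have f0 z : (0 <= f z)%E by rewrite lee_fin mulr_ge0.
  pose XR : {mfun T >-> mR} := HB.pack (X n : T -> mR)
    (isMeasurableFun.Build _ _ T mR (X n : T -> mR) (measurable_funPT (X n))).
  have E := @ge0_integral_independent _ _ _ _ _ P (observed X n)
    (observed_sigma X n) (@observed_measurable _ _ _ X n) XR Q
    (@observed_independent n) f mf f0.
  rewrite integral_mkcond.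
  rewrite (eq_integral (fun w => f (w, X n w))); last first.
    move=> w _; rewrite patchE /f /= indicE /factor_product big_ord_recr/=.
    by case: (w \in A); rewrite ?mul1r ?mul0r.
  rewrite E [leRHS]integral_mkcond.
  rewrite [leRHS](eq_integral (fun w => (\1_A w * factor_product n w)%:E)); last first.
    by move=> w _; rewrite patchE indicE; case: (w \in A); rewrite ?mul1r ?mul0r.
  apply: ge0_le_integral => //.
  - by move=> w _; apply: integral_ge0.
  - have := @measurable_fun_fubini_tonelli_F _ _ (TX n) mR R Q f mf f0.
    move=> mF _ B mB; apply: (@observed_measurable _ _ _ X n).
    by rewrite -measurable_observedE; exact: mF.
  - apply/measurable_EFinP => _ B mB; apply: (@observed_measurable _ _ _ X n).
    by rewrite -measurable_observedE; exact: mLA.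
  - move=> w _; rewrite /f /=.
    under eq_integral do rewrite EFinM.
    rewrite ge0_integralZl//.
    + by rewrite -[leRHS]mule1 lee_wpmul2l// lee_fin.
    + apply/measurable_EFinP.
      exact: (@measurable_fun_pair2 _ _ _ (TX n) mR R _ w (@mg n)).
    + by move=> y _; rewrite lee_fin.
    + by rewrite lee_fin.
Qed.

End likelihood_ratio.
End iid_observations.

(** * Ville's inequality through first passage *)

Section ville.
Context {d : measure_display} {T : measurableType d} {R : realType}.
Variables (P : probability T R) (G : filtration T) (M : nat -> T -> R) (c : R).

(** The strict threshold matches the complement of the closed confidence interval. *)
Definition first_passage (w : T) : option nat :=
  if pselect (exists n, c < M n w) is left h then Some (ex_minn h) else None.

Hypotheses (GM : adapted G M) (M_ge0 : forall n w, 0 <= M n w) (c0 : 0 < c).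

Let passed n : G n [set w | c < M n w].
Proof.
rewrite (_ : [set w | _] = M n @^-1` `]c, +oo[).
  by apply: GM; exact: measurable_itv.
by apply/seteqP; split => w /=; rewrite in_itv/= andbT.
Qed.

Lemma first_passage_stopping_time : stopping_time G first_passage.
Proof.
move=> n.
rewrite (_ : [set w | _] = \bigcup_(k in `I_n.+1) [set w | c < M k w]).
  rewrite -(filtration_measurableE G n).
  apply: (@fin_bigcup_measurable _ (g_sigma_algebraType (G n))) => // k.
  rewrite /= ltnS => kn; rewrite filtration_measurableE.
  exact: (filtration_le kn).
rewrite /first_passage; apply/seteqP; split => w /=.
  move=> [k kn]; case: pselect => // h [hk].
  by exists k => //=; rewrite -hk; case: ex_minnP.
move=> [k kn /= ck]; case: pselect => [h|/(_ (ex_intro _ k ck))//].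
by exists (ex_minn h) => //; case: ex_minnP => j _ /(_ _ ck) /leq_trans; apply.
Qed.

(** Markov's inequality for the value stopped at first passage, which exceeds [c] on the union.
    Since the assumption bounds this stopped value, a process merely dominated by a supermartingale
    qualifies. *)
Lemma ville_inequality :
  (\int[P]_w stopped (fun n w => (M n w)%:E) first_passage w <= 1)%E ->
  (P (\bigcup_n [set w | (c < M n w)%R]) <= (c^-1)%:E)%E.
Proof.
set S := stopped _ _ => intS.
have mS : measurable_fun setT S.
  exact: measurable_stopped GM first_passage_stopping_time.
have S0 w : (0 <= S w)%E.
  rewrite /S stopped_limn_esup; apply: le_trans (limn_einf_sup _).
  by apply: limn_einf_ge0 => n; rewrite lee_fin; exact: M_ge0.
have := le_integral_abse P measurableT mS c0; rewrite setTI.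
under eq_integral do rewrite gee0_abs//.
move=> /le_trans /(_ intS) cP.
rewrite -[leRHS]mule1 lee_pdivlMl//; apply: le_trans cP.
rewrite lee_pmul2l// ?lte_fin//.
apply: le_measure; rewrite ?inE.
- by apply: bigcup_measurable => n _; exact: (filtration_measurable (passed n)).
- rewrite -[X in measurable X]setTI.
  by apply: emeasurable_fun_c_infty => //; exact: measurableT_comp.
move=> w [n _ /= cn]; rewrite gee0_abs// /S /stopped /first_passage.
case: pselect => [h|/(_ (ex_intro _ n cn))//].
by case: ex_minnP => k ck _; rewrite lee_fin ltW.
Qed.

End ville.

(** * Ratios of Gaussian densities *)

Section gaussian_ratio.
Context {R : realType}.
Implicit Types m s mu sigma x y : R.

(** The Radon-Nikodym derivative and [normal_pdf] have the same integral over every measurable set,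
    hence agree almost everywhere. *)
Lemma ge0_integral_normal_prob m s (f : measurableTypeR R -> \bar R) :
  measurable_fun setT f -> (forall x, (0 <= f x)%E) ->
  (\int[normal_prob m s]_x f x =
   \int[lebesgue_measure]_x (f x * (normal_pdf m s x)%:E))%E.
Proof.
move=> mf f0; have dom := normal_prob_dominates m s.
rewrite -(Radon_Nikodym_SigmaFinite.change_of_variables dom)//.
have iRN := Radon_Nikodym_SigmaFinite.f_integrable dom.
have mpdf : measurable_fun setT (fun x : measurableTypeR R => (normal_pdf m s x)%:E).
  by apply/measurable_EFinP; exact: measurable_normal_pdf.
apply: ae_eq_integral => //.
- by apply: emeasurable_funM => //; exact: measurable_int iRN.
- exact: emeasurable_funM.
- apply: ae_eqe_mul2l; apply: integral_ae_eq => // E _ mE.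
  by rewrite -Radon_Nikodym_SigmaFinite.f_integral.
Qed.

(** The density of N(mu, sigma^2) over that of N(m, s^2), with the common factor [sqrt (2 pi)]
    cancelled. *)
Definition normal_ratio m s mu sigma y :=
  s / sigma * expR (2^-1 * ((y - m) / s) ^+ 2 - 2^-1 * ((y - mu) / sigma) ^+ 2).

Lemma normal_ratio_ge0 m s mu sigma y : 0 < s -> 0 < sigma ->
  0 <= normal_ratio m s mu sigma y.
Proof. by move=> s0 sg0; rewrite mulr_ge0 ?expR_ge0// divr_ge0// ltW. Qed.

Lemma normal_peakE s : 0 < s -> normal_peak s = s^-1 * (Num.sqrt (pi *+ 2))^-1.
Proof.
move=> s0; rewrite /normal_peak -mulrnAr sqrtrM ?sqr_ge0//.
by rewrite sqrtr_sqr gtr0_norm// invfM.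
Qed.

Lemma normal_ratio_pdf m s mu sigma y : 0 < s -> 0 < sigma ->
  normal_ratio m s mu sigma y * normal_pdf m s y = normal_pdf mu sigma y.
Proof.
move=> s0 sg0; rewrite !normal_pdfE ?gt_eqF// /normal_ratio !normal_peakE//.
rewrite /normal_fun.
have -> : - (y - m) ^+ 2 / (s ^+ 2 *+ 2) = - (2^-1 * ((y - m) / s) ^+ 2).
  by field; rewrite gt_eqF.
have -> : - (y - mu) ^+ 2 / (sigma ^+ 2 *+ 2) = - (2^-1 * ((y - mu) / sigma) ^+ 2).
  by field; rewrite gt_eqF.
set u := 2^-1 * _; set v := 2^-1 * _.
have -> : s / sigma * expR (u - v) * (s^-1 / Num.sqrt (pi *+ 2) * expR (- u)) =
    s / s * (sigma^-1 / Num.sqrt (pi *+ 2)) * (expR (u - v) * expR (- u)) by ring.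
by rewrite -expRD divff ?gt_eqF// mul1r; congr (_ * expR _); ring.
Qed.

Lemma measurable_normal_ratio d (S : measurableType d) m s (mu sigma y : S -> R) :
  (forall z, 0 < sigma z) ->
  measurable_fun setT mu -> measurable_fun setT sigma -> measurable_fun setT y ->
  measurable_fun setT (fun z => normal_ratio m s (mu z) (sigma z) (y z)).
Proof.
move=> sg0 mmu msigma my.
have mV := measurable_funV_gt0 sg0 msigma.
apply: measurable_funM; first exact: measurable_funM.
apply: measurableT_comp => //.
apply: measurable_funB; apply: measurable_funM => //; apply: measurable_funX.
  by apply: measurable_funM => //; exact: measurable_funB.
by apply: measurable_funM => //; exact: measurable_funB.
Qed.

Lemma integral_normal_ratio m s mu sigma : 0 < s -> 0 < sigma ->
  (\int[normal_prob m s]_y (normal_ratio m s mu sigma y)%:E = 1)%E.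
Proof.
move=> s0 sg0; rewrite ge0_integral_normal_prob.
- under eq_integral do rewrite -EFinM normal_ratio_pdf//.
  exact: integral_normal_pdf.
- by apply/measurable_EFinP; apply: measurable_normal_ratio.
- by move=> y; rewrite lee_fin normal_ratio_ge0.
Qed.

End gaussian_ratio.

(* The left-hand side is the right-hand side at its minimiser [s = sqrt V]. *)
Lemma powR_normal_bound {R : realType} (n : nat) (s V : R) : 0 < s -> 0 <= V ->
  V `^ (n%:R / 2) * expR (n%:R / 2) <= s ^+ n * expR (2^-1 * (n%:R * V / s ^+ 2)).
Proof.
move=> s0 V0; have s20 : 0 < s ^+ 2 by rewrite exprn_gt0.
have n20 : 0 <= n%:R / 2 :> R by rewrite divr_ge0.
(* This is [u <= exp (u - 1)] at [u = V / s ^+ 2]; raising it to the power [n / 2] gives the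
   claim. *)
have Vle : V <= s ^+ 2 * expR (V / s ^+ 2 - 1).
  rewrite mulrC -ler_pdivrMr//; apply: le_trans (expR_ge1Dx _).
  by rewrite addrC subrK.
have -> : s ^+ n * expR (2^-1 * (n%:R * V / s ^+ 2)) =
    (s ^+ 2 * expR (V / s ^+ 2 - 1)) `^ (n%:R / 2) * expR (n%:R / 2).
  rewrite powRM ?expR_ge0 ?ltW// -expRM -[RHS]mulrA -expRD; congr (_ * expR _).
    rewrite -powR_mulrn ?(ltW s0)// -[s ^+ 2]powR_mulrn ?(ltW s0)// -powRrM.
    by congr (_ `^ _); field.
  by field; rewrite gt_eqF.
rewrite ler_pM2r ?expR_gt0//; apply: ge0_ler_powR => //; rewrite nnegrE//.
exact: le_trans Vle.
Qed.

(** * The process centered at a candidate mean, and its confidence set *)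

Section centered_process.
Context {R : realType} {d : measure_display} {T : measurableType d}.
Variables (X : nat -> {mfun T >-> R}) (mu sigma : nat -> T -> R) (m : R).

Definition mean_sq_dev (n : nat) (w : T) : R :=
  n%:R^-1 * \sum_(i < n) (X i w - m) ^+ 2.

Definition residual_density (n : nat) (w : T) : R :=
  \prod_(i < n) ((sigma i w)^-1 *
                 expR (- (1 / 2) * ((X i w - mu i w) / sigma i w) ^+ 2)).

(** Only the second moment is centered at [m]; the residuals keep the raw observations. At [m = 0]
    this is [R_process]. *)
Definition centered_process (n : nat) (w : T) : R :=
  if n == 0%N then 1 else
  mean_sq_dev n w `^ (n%:R / 2) * expR (n%:R / 2) * residual_density n w.

Hypothesis mu_adapted : adapted (canonical_filtration X) mu.
Hypothesis sigma_adapted : adapted (canonical_filtration X) sigma.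
Hypothesis sigma_gt0 : forall n w, 0 < sigma n w.

Lemma mean_sq_dev_ge0 n w : 0 <= mean_sq_dev n w.
Proof. by rewrite mulr_ge0// sumr_ge0// => i _; rewrite sqr_ge0. Qed.

Lemma residual_density_gt0 n w : 0 < residual_density n w.
Proof. by apply: prodr_gt0 => i _; rewrite mulr_gt0 ?expR_gt0// invr_gt0. Qed.

Lemma centered_process_ge0 n w : 0 <= centered_process n w.
Proof.
rewrite /centered_process; case: ifP => // _.
by rewrite !mulr_ge0 ?powR_ge0 ?expR_ge0// ltW// residual_density_gt0.
Qed.

Lemma adapted_centered_process : adapted (canonical_filtration X) centered_process.
Proof.
apply/adapted_canonicalP => n; rewrite /centered_process.
case: eqP => _; first exact: measurable_cst.
pose TX := g_sigma_algebraType (observed X n).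
have mX i : (i < n)%N -> measurable_fun setT (X i : TX -> R).
  exact: measurable_observation.
have mmu i : (i < n)%N -> measurable_fun setT (mu i : TX -> R).
  move=> ltin; apply: (measurable_observed_le (ltnW ltin)).
  exact: ((adapted_canonicalP X mu).1 mu_adapted).
have mV i : (i < n)%N -> measurable_fun setT (fun w : TX => (sigma i w)^-1).
  move=> ltin; apply: measurable_funV_gt0 => //.
  apply: (measurable_observed_le (ltnW ltin)).
  exact: ((adapted_canonicalP X sigma).1 sigma_adapted).
apply: measurable_funM; first apply: measurable_funM => //.
  apply: (measurableT_comp (@measurable_powR R (n%:R / 2))).
  apply: measurable_funM => //; apply: measurable_sum => i.
  by apply: measurable_funX; apply: measurable_funB => //; exact: mX.
apply: measurable_prod => i _; apply: measurable_funM; first exact: mV.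
apply: measurableT_comp => //; apply: measurable_funM => //; apply: measurable_funX.
apply: measurable_funM; last exact: mV.
by apply: measurable_funB; [exact: mX|exact: mmu].
Qed.

(** Multiplying the ratios collects the true density into a function of [s] and [mean_sq_dev]; the
    remaining factor [residual_density] is common to both sides. *)
Lemma centered_process_le (s : R) n w : 0 < s ->
  centered_process n w <=
  factor_product X (fun i w y => normal_ratio m s (mu i w) (sigma i w) y) n w.
Proof.
move=> s0; rewrite /centered_process /factor_product.
have [->|n0] := eqVneq n 0%N; first by rewrite big_ord0.
have -> : \prod_(i < n) normal_ratio m s (mu i w) (sigma i w) (X i w) =
    s ^+ n * expR (2^-1 * (n%:R * mean_sq_dev n w / s ^+ 2)) * residual_density n w.
  have -> : 2^-1 * (n%:R * mean_sq_dev n w / s ^+ 2) =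
      \sum_(i < n) 2^-1 * ((X i w - m) / s) ^+ 2.
    rewrite /mean_sq_dev mulVKf ?pnatr_eq0// mulr_suml mulr_sumr.
    by apply: eq_bigr => i _; field; rewrite gt_eqF.
  have -> : s ^+ n = \prod_(i < n) s by rewrite prodr_const card_ord.
  rewrite expR_sum -!big_split /=; apply: eq_bigr => i _.
  rewrite /normal_ratio expRD mulNr div1r; ring.
by rewrite ler_pM2r ?residual_density_gt0// powR_normal_bound// mean_sq_dev_ge0.
Qed.

(** The dominating supermartingale depends on the unknown [s], the centered process does not.
    Domination at each time passes to the stopped values through the upper limits. *)
Lemma stopped_centered_process_le1 (s : R) (P : probability T R) tau : 0 < s ->
  iid_from (normal_prob m s) P X -> stopping_time (canonical_filtration X) tau ->
  (\int[P]_w stopped (fun n w => (centered_process n w)%:E) tau w <= 1)%E.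
Proof.
move=> s0 iidX Xtau.
pose g i w y := normal_ratio m s (mu i w) (sigma i w) y.
have superL : ge0_supermartingale P (canonical_filtration X) (factor_product X g).
  apply: (factor_product_supermartingale iidX).
  - move=> n; apply: measurable_normal_ratio => //.
    + apply: (@measurableT_comp _ _ _ _ _ _
        (mu n : g_sigma_algebraType (observed X n) -> R) _ fst) => //.
      exact: ((adapted_canonicalP X mu).1 mu_adapted).
    + apply: (@measurableT_comp _ _ _ _ _ _
        (sigma n : g_sigma_algebraType (observed X n) -> R) _ fst) => //.
      exact: ((adapted_canonicalP X sigma).1 sigma_adapted).
  - by move=> n w y; exact: normal_ratio_ge0.
  - by move=> n w; rewrite integral_normal_ratio.
have L0 : (\int[P]_w (factor_product X g 0 w)%:E = 1)%E.
  rewrite (eq_integral (cst 1%E)).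
    by rewrite integral_cst//= probability_setT mule1.
  by move=> w _; rewrite /factor_product big_ord0.
have GL : adapted (canonical_filtration X) (factor_product X g) by case: superL.
rewrite -L0; apply: le_trans (stopped_supermartingale_le superL _ Xtau);
  last by rewrite L0 ltry.
apply: ge0_le_integral => //.
- move=> w _; rewrite stopped_limn_esup; apply: le_trans (limn_einf_sup _).
  by apply: limn_einf_ge0 => n; rewrite lee_fin; exact: centered_process_ge0.
- exact: measurable_stopped adapted_centered_process Xtau.
- exact: measurable_stopped GL Xtau.
- move=> w _; rewrite !stopped_limn_esup; apply: le_limn_esup => n.
  by rewrite lee_fin; exact: centered_process_le.
Qed.

(** This shows that [W_process] is the value of the mean squared deviation at which the centered
    process equals [alpha^-1]. *)
Lemma W_process_powR alpha n w : 0 < alpha -> (0 < n)%N ->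
  W_process X mu sigma alpha n w `^ (n%:R / 2) =
  alpha^-1 / (expR (n%:R / 2) * residual_density n w).
Proof.
move=> a0 n0; have nn0 : n%:R != 0 :> R by rewrite pnatr_eq0 -lt0n.
pose z i := (X i w - mu i w) / sigma i w.
have resE : residual_density n w =
    expR (- (2^-1 * \sum_(i < n) (ln (sigma i w ^+ 2) + z i ^+ 2))).
  rewrite mulr_sumr -sumrN expR_sum; apply: eq_bigr => i _.
  rewrite lnXn// -{1}[sigma i w]lnK ?posrE// -expRN -expRD; congr expR.
  by rewrite /z; field; rewrite gt_eqF.
rewrite /W_process -/(residual_density _ _) resE.
have -> : alpha `^ (2 / n%:R) = expR (2 / n%:R * ln alpha).
  by rewrite /powR gt_eqF.
rewrite -{2}[alpha]lnK ?posrE// -!expRD -!expRN -!expRD -expRM; congr expR.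
by field.
Qed.

Lemma CI_centered_processE alpha n w : 0 < alpha -> (0 < n)%N ->
  CI X mu sigma alpha n w m <-> centered_process n w <= alpha^-1.
Proof.
move=> a0 n0; have nn0 : n%:R != 0 :> R by rewrite pnatr_eq0 -lt0n.
have V0 := mean_sq_dev_ge0 n w; have r0 := residual_density_gt0 n w.
set W := W_process X mu sigma alpha n w.
have W0 : 0 <= W by rewrite mulr_ge0 ?expR_ge0// invr_ge0 mulr_ge0 ?expR_ge0 ?powR_ge0.
(* On the process side, the increasing power [n / 2] compares [mean_sq_dev] with [W]; on the
   interval side, expanding the square around the sample mean does. *)
transitivity (mean_sq_dev n w <= W); last first.
  rewrite /centered_process (gtn_eqF n0) -mulrA.
  rewrite -[X in _ <-> is_true X]ler_pdivlMr ?mulr_gt0 ?expR_gt0//.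
  rewrite -W_process_powR// -/W.
  have n20 : 0 < n%:R / 2 :> R by rewrite divr_gt0// ltr0n.
  split=> [VW|]; first by apply: ge0_ler_powR; rewrite ?nnegrE// ltW.
  by apply: contraTT; rewrite -!ltNge => WV; apply: gt0_ltr_powR; rewrite ?nnegrE.
have VE : mean_sq_dev n w = (m - sample_mean X n w) ^+ 2 - sample_mean X n w ^+ 2
    + sample_mean_sq X n w.
  rewrite /mean_sq_dev /sample_mean /sample_mean_sq.
  under eq_bigr do rewrite sqrrB.
  rewrite big_split sumrB /= sumr_const card_ord sumrMnl -mulr_suml.
  rewrite -[m ^+ 2 *+ n]mulr_natl.
  set S := \sum_(i < n) _; set S2 := \sum_(i < n) _.
  by field.
rewrite /CI /= -/W VE; set D := _ - _ + W; set a := sample_mean _ _ _.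
have -> : ((m - a) ^+ 2 - a ^+ 2 + sample_mean_sq X n w <= W) = ((m - a) ^+ 2 <= D).
  by rewrite /D -/a; apply/idP/idP; lra.
(* For negative [D] the interval is empty, and no square lies below [D]. *)
have [D0|D0] := leP 0 D; last first.
  by split => // /le_lt_trans /(_ D0); rewrite ltNge sqr_ge0.
have -> : ((m - a) ^+ 2 <= D) = (`|m - a| <= Num.sqrt D).
  by rewrite -sqrtr_sqr ler_sqrt.
rewrite /= in_itv/= ler_norml; split=> /andP[h1 h2]; apply/andP; split; lra.
Qed.

End centered_process.

(** * The e-process and the confidence sequence *)

Theorem theorem3p2 (R : realType) (d : measure_display) (T : measurableType d)
    (X : nat -> {mfun T >-> R}) (mu sigma : nat -> T -> R)
    (mu_adapted : adapted (canonical_filtration X) mu)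
    (sigma_adapted : adapted (canonical_filtration X) sigma)
    (sigma_gt0 : forall n w, 0 < sigma n w) :
  e_process X (@centered_normals R) (canonical_filtration X)
    (fun n w => (R_process X mu sigma n w)%:E) /\
  (forall alpha : R, 0 < alpha < 1 ->
   forall (m s : R), 0 < s ->
   forall P : probability T R, iid_from (normal_prob m s) P X ->
     ((1 - alpha)%:E <=
        P [set w | forall n, (1 <= n)%N -> CI X mu sigma alpha n w m])%E).
Proof.
split.
  have -> : R_process X mu sigma = centered_process X mu sigma 0.
    apply/funext => n; apply/funext => w; rewrite /R_process /centered_process.
    rewrite /mean_sq_dev /sample_mean_sq; congr (if _ then _ else _ `^ _ * _ * _).
    by congr (_ * _); apply: eq_bigr => i _; rewrite subr0.
  split.
  - move=> n B mB.
    by apply: (@adapted_centered_process _ _ _ X mu sigma 0 mu_adapted sigma_adapted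
      sigma_gt0 n (EFin @^-1` B));
      rewrite -[X in measurable X]setTI; exact: EFin_measurable.
  - by move=> n w; rewrite lee_fin centered_process_ge0.
  - move=> tau Xtau _ [s s0 <-] P iidX.
    exact: (stopped_centered_process_le1 _ _ _ s0 iidX Xtau).
move=> alpha /andP[a0 a1] m s s0 P iidX.
pose C := centered_process X mu sigma m.
pose bad := \bigcup_n [set w | alpha^-1 < C n w].
have GC : adapted (canonical_filtration X) C by exact: adapted_centered_process.
have -> : [set w | forall n, (1 <= n)%N -> CI X mu sigma alpha n w m] = ~` bad.
  apply/seteqP; split => w /=.
    move=> cov [[|n] _] /=.
      (* Time 0 adds nothing to [bad]: the process starts at 1, which is below [alpha^-1]. *)
      by rewrite /C /centered_process eqxx ltNge invf_ge1// ltW.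
    have := cov n.+1 isT.
    move/(CI_centered_processE X mu m sigma_gt0 w a0 (ltn0Sn n)).
    by rewrite leNgt => /negP.
  move=> nbad n n0; apply/(CI_centered_processE X mu m sigma_gt0 w a0 n0).
  by rewrite leNgt; apply/negP => h; apply: nbad; exists n.
have badle : (P bad <= alpha%:E)%E.
  (* Ville's inequality is applied at the threshold [alpha^-1]. *)
  rewrite -[alpha]invrK.
  apply: (@ville_inequality _ _ _ P (canonical_filtration X)) => //.
  - by move=> n w; exact: centered_process_ge0.
  - by rewrite invr_gt0.
  - apply: (stopped_centered_process_le1 _ _ _ s0 iidX) => //.
    exact: first_passage_stopping_time.
have mbad : measurable bad.
  apply: bigcup_measurable => n _.
  rewrite (_ : [set w | _] = C n @^-1` `]alpha^-1, +oo[).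
    rewrite -[X in measurable X]setTI; apply: (adapted_measurable n GC) => //.
  by apply/seteqP; split => w /=; rewrite in_itv/= andbT.
by rewrite probability_setC// EFinB leeB.
Qed.
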